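(* Let $\lambda$ be a positive real constant such that, for every positive integer $n$ and all vectors $\mathbf{a}=(a_1,\ldots,a_n)$ and $\mathbf{b}=(b_1,\ldots,b_n)$ of positive real numbers, we have $$\left(T_{\mathbf{a},\mathbf{b}}\right)^2\leq 2S_{\mathbf{a},\mathbf{b}}^{(2)}+\lambda\sqrt{S_{\mathbf{a},\mathbf{b}}^{(1)}S_{\mathbf{a},\mathbf{b}}^{(3)}}.$$ Then $\lambda\geq 2\sqrt{2}$.
   Context: For a positive integer $n$ and two vectors $\mathbf{a}=(a_1,\ldots,a_n)$ and $\mathbf{b}=(b_1,\ldots,b_n)$ of positive real numbers, define $$T_{\mathbf{a},\mathbf{b}}=\sum_{k=1}^n\frac{a_k}{b_k},\qquad S_{\mathbf{a},\mathbf{b}}^{(m)}=\sum_{k=1}^n\sum_{l=1}^n\frac{a_ka_l}{(b_k+b_l)^m}\quad\text{for } m=1,2,3.$$ *)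

(* Defs.v *)
From HB Require Import structures.
From mathcomp Require Import all_boot all_order all_algebra.
From mathcomp Require Import reals.

Set Implicit Arguments.
Unset Strict Implicit.
Unset Printing Implicit Defensive.

Import Order.TTheory GRing.Theory Num.Theory.

Local Open Scope ring_scope.

Definition positive_vector (R : realType) (n : nat) (a : 'rV[R]_n) : Prop :=
  forall k : 'I_n, 0 < a 0 k.

Definition T_sum (R : realType) (n : nat) (a b : 'rV[R]_n) : R :=
  \sum_(k < n) a 0 k / b 0 k.

Definition S_sum (R : realType) (n : nat) (m : nat) (a b : 'rV[R]_n) : R :=
  \sum_(k < n) \sum_(l < n) (a 0 k * a 0 l) / (b 0 k + b 0 l) ^+ m.

(* Main.v *)
Require Import Defs.
From HB Require Import structures.
From mathcomp Require Import all_boot all_order all_algebra.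
From mathcomp Require Import reals.
From mathcomp Require Import zify ring lra.

Set Implicit Arguments.
Unset Strict Implicit.
Unset Printing Implicit Defensive.

Import Order.TTheory GRing.Theory Num.Theory.

Local Open Scope ring_scope.

(** With F(t) = \sum_k a_k exp(- b_k t) one has T = \int F, S^(1) = \int F^2,
    S^(2) = \int t F^2 and S^(3) = (1/2) \int t^2 F^2, the integrals being over
    t > 0.  For lambda = 2 sqrt 2 the resulting integral inequality is an
    equality at F(t) = 1 / (1 + t)^2, where T, S^(1), S^(2), S^(3) are
    1, 1/3, 1/6, 1/6.  This F is the Laplace transform of x exp(- x), so
    vectors that discretize that density show that no smaller constant works.

    By homogeneity the mesh may be taken to be 1: put b_k = k and a_k = k q^k
    for 1 <= k <= n, where q = 1 - e with e small.  Then T is a geometric sum,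
    e T = q (1 - q^n) ([mul_T_sum_geometric]), and q^n <= e for a suitable n
    ([exists_expr_le]), so that e T >= (1 - e)^2.  Grouping the terms of S^(m)
    by s = k + l, the weight of q^s / s^m is at most
    \sum_(k + l = s) k l = (s^3 - s) / 6 <= s^3 / 6, so that S^(m) is bounded
    by a negative binomial series: S^(m) <= (3 - m)! / (6 e^(4 - m))
    ([S_sum_geometric_le]).  After substitution the powers of e cancel and
    (1 - e)^4 <= 1/3 + lambda sqrt 2 / 6 remains for every small e, hence
    1 <= 1/3 + lambda sqrt 2 / 6, which is lambda >= 2 sqrt 2. *)

(** * Sums over the diagonals of a square *)

Lemma sum_succ t : (\sum_(i < t.+1) i.+1 = 'C(t.+2, 2))%N.
Proof.
elim: t => [|t IH]; first by rewrite big_ord1.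
by rewrite big_ord_recr /= IH [RHS]binS bin1.
Qed.

(** The coefficient of X^t in (1 - X)^-2 * (1 - X)^-2 = (1 - X)^-4. *)
Lemma sum_succ_mul_succ t :
  (\sum_(i < t.+1) i.+1 * (t - i).+1 = 'C(t.+3, 3))%N.
Proof.
elim: t => [|t IH]; first by rewrite big_ord1.
rewrite big_ord_recr /= subnn muln1.
under eq_bigr => i _ do rewrite subSn ?leq_ord // mulnS addnC.
rewrite big_split /= IH -addnA.
have -> : (\sum_(i < t.+1) i.+1 + t.+2 = 'C(t.+3, 2))%N.
  by rewrite -sum_succ [RHS]big_ord_recr.
by rewrite -binS.
Qed.

Lemma ler_sum_widen (R : numDomainType) (m n : nat) (f : nat -> R) :
  (m <= n)%N -> (forall i, 0 <= f i) -> \sum_(i < m) f i <= \sum_(i < n) f i.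
Proof.
move=> /subnKC <- f0; rewrite big_split_ord /= lerDl.
by apply: sumr_ge0 => i _.
Qed.

Lemma sum_triangle_diagonals (R : nmodType) (N : nat) (F : nat -> nat -> R) :
  \sum_(i < N) \sum_(j < N - i) F i j
    = \sum_(t < N) \sum_(i < t.+1) F i (t - i)%N.
Proof.
elim: N => [|N IH]; first by rewrite !big_ord0.
rewrite [RHS]big_ord_recr /= -IH.
under eq_bigr => i _ do rewrite subSn ?leq_ord // big_ord_recr /=.
by rewrite big_split /= [X in X + _]big_ord_recr /= subnn big_ord0 addr0.
Qed.

(** The square of side n lies in the triangle i + j < n + n. *)
Lemma sum_square_le_diagonals (R : numDomainType) (n : nat)
    (F : nat -> nat -> R) :
  (forall i j, 0 <= F i j) ->
  \sum_(i < n) \sum_(j < n) F i j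
    <= \sum_(t < n + n) \sum_(i < t.+1) F i (t - i)%N.
Proof.
move=> F0; rewrite -sum_triangle_diagonals.
apply: (@le_trans _ _ (\sum_(i < n) \sum_(j < n + n - i) F i j)).
  apply: ler_sum => i _; apply: ler_sum_widen => //.
  by rewrite -addnBA ?leq_addr // ltnW.
apply: (ler_sum_widen (f := fun i => \sum_(j < n + n - i) F i j)).
  exact: leq_addr.
by move=> i; apply: sumr_ge0.
Qed.

(** * Partial sums of the negative binomial series *)

(** Truncated form of (1 - q) (1 - q)^-(j + 2) = (1 - q)^-(j + 1): by Pascal's
    rule, multiplying by 1 - q lowers the order of the binomial series, up to a
    boundary term of known sign. *)
Lemma mul_sum_bin_expr_le (R : realDomainType) (q : R) (j M : nat) : 0 <= q ->
  (1 - q) * \sum_(t < M) 'C(t + j.+1, j.+1)%:R * q ^+ t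
    <= \sum_(t < M) 'C(t + j, j)%:R * q ^+ t.
Proof.
move=> q0.
(* the induction on M needs the exact boundary term *)
suff -> : (1 - q) * \sum_(t < M) 'C(t + j.+1, j.+1)%:R * q ^+ t
  = \sum_(t < M) 'C(t + j, j)%:R * q ^+ t - 'C(M + j, j.+1)%:R * q ^+ M.
  by rewrite gerBl mulr_ge0 ?exprn_ge0 ?ler0n.
elim: M => [|M IH]; first by rewrite !big_ord0 mulr0 add0n bin_small // mul0r subr0.
rewrite !big_ord_recr /= mulrDr IH addnS addSn binS natrD exprS; ring.
Qed.

Lemma sum_bin_expr_le (R : realFieldType) (q : R) (j M : nat) : 0 <= q < 1 ->
  \sum_(t < M) 'C(t + j, j)%:R * q ^+ t <= (1 - q) ^- j.+1.
Proof.
move=> /andP[q0 q1]; have e0 : 0 < 1 - q by rewrite subr_gt0.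
elim: j => [|j IH].
  rewrite expr1 -[leRHS]mul1r ler_pdivlMr // mulrC.
  under eq_bigr do rewrite bin0 mul1r.
  by rewrite -opprB mulNr -subrX1 opprB gerBl exprn_ge0.
rewrite exprSr invfM ler_pdivlMr // mulrC.
exact: le_trans (mul_sum_bin_expr_le _ _ q0) IH.
Qed.

Lemma expn_le_fact_bin u j : (u.+1 ^ j <= j`! * 'C(u + j, j))%N.
Proof.
rewrite mulnC bin_ffact; elim: j => // j IH.
by rewrite addnS ffactSS expnS leq_mul // ltnS leq_addr.
Qed.

(** * The sums T and S^(m) for a_k = k q^k and b_k = k *)

Definition geometric_vector (R : realType) (q : R) (n : nat) : 'rV[R]_n :=
  \row_(k < n) (k.+1%:R * q ^+ k.+1).

Definition integer_vector (R : realType) (n : nat) : 'rV[R]_n :=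
  \row_(k < n) k.+1%:R.

Lemma mul_T_sum_geometric (R : realType) (q : R) (n : nat) :
  (1 - q) * T_sum (geometric_vector q n) (integer_vector R n)
    = q * (1 - q ^+ n).
Proof.
rewrite /T_sum.
under eq_bigr => k _ do rewrite !mxE mulrC mulrA mulVf ?pnatr_eq0 // mul1r exprS.
rewrite -big_distrr /= mulrCA; congr (_ * _).
by rewrite -opprB mulNr -subrX1 opprB.
Qed.

(** In the diagonal k + l = t of 0-based indices the denominators are
    (t + 2)^(3 - j), and the numerators add up to 'C(t + 3, 3) q^(t + 2), where
    'C(t + 3, 3) <= (t + 2)^3 / 6.  The remaining factor (t + 2)^j / 6 is at most
    j! / 6 times a coefficient of the series of (1 - q)^-(j + 1). *)
Lemma S_sum_geometric_le (R : realType) (q : R) (n j : nat) :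
  0 < q < 1 -> (j <= 3)%N ->
  S_sum (3 - j) (geometric_vector q n) (integer_vector R n)
    <= (j`!%:R / 6) / (1 - q) ^+ j.+1.
Proof.
move=> /andP[q0 q1] j3.
pose w (s : nat) : R := q ^+ s.+2 / s.+2%:R ^+ (3 - j).
have w0 s : 0 <= w s by rewrite divr_ge0 ?exprn_ge0 ?ler0n // ltW.
rewrite /S_sum.
under eq_bigr => k _ do under eq_bigr => l _ do
  rewrite !mxE mulrACA -exprD -natrD -natrM addSn addnS -mulrA
    -/(w (k + l)%N).
apply: le_trans (sum_square_le_diagonals n
  (F := fun k l => (k.+1 * l.+1)%:R * w (k + l)%N) _) _.
  by move=> k l; rewrite mulr_ge0 ?ler0n.
have diag (t : nat) : \sum_(i < t.+1) (i.+1 * (t - i).+1)%:R * w (i + (t - i))%N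
    <= j`!%:R / 6 * ('C(t.+1 + j, j)%:R * q ^+ t.+1).
  under eq_bigr => i _ do rewrite subnKC ?leq_ord //.
  rewrite -big_distrl /= -natr_sum sum_succ_mul_succ /w.
  have c_le : ('C(t.+3, 3) * 6 <= t.+2 ^ 3)%N.
    rewrite -[6%N]/(3`!) bin_ffact !ffactnS ffactn0 /= muln1 !expnS expn0 muln1.
    (* (t + 1) (t + 3) <= (t + 2)^2 *)
    nia.
  have d_le := expn_le_fact_bin t.+1 j.
  have e_le : 'C(t.+3, 3)%:R * 6
      <= j`!%:R * 'C(t.+1 + j, j)%:R * t.+2%:R ^+ (3 - j) :> R.
    rewrite -natrX -!natrM ler_nat (leq_trans c_le) //.
    by rewrite -[in leqLHS](subnKC j3) expnD leq_mul2r d_le orbT.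
  rewrite mulrA ler_pdivrMr ?exprn_gt0 ?ltr0n //.
  (* one spare factor q aligns the exponent with the binomial index t + 1 *)
  have qle : q ^+ t.+2 <= q ^+ t.+1 by rewrite ler_wiXn2l ?ltW.
  apply: (@le_trans _ _ ('C(t.+3, 3)%:R * q ^+ t.+1)).
    by rewrite ler_wpM2l ?ler0n.
  have q10 : 0 <= q ^+ t.+1 by rewrite exprn_ge0 // ltW.
  have := ler_wpM2r q10 e_le; nra.
apply: (@le_trans _ _
  (\sum_(t < n + n) j`!%:R / 6 * ('C(t.+1 + j, j)%:R * q ^+ t.+1))).
  by apply: ler_sum => t _; apply: diag.
rewrite -big_distrr /= ler_wpM2l ?divr_ge0 ?ler0n //.
apply: le_trans (sum_bin_expr_le j (n + n).+1 _); last by rewrite ltW.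
(* the series bound starts at index 0, the diagonals at index 1 *)
by rewrite [leRHS]big_ord_recl lerDr mulr_ge0 ?ler0n ?exprn_ge0 // ltW.
Qed.

(** * The limit *)

Lemma exists_expr_le (R : realType) (e : R) : 0 < e < 1 ->
  exists2 n, (0 < n)%N & (1 - e) ^+ n <= e.
Proof.
move=> /andP[e0 e1].
have [n hn] : exists n : nat, e^-2 < n%:R.
  exists (Num.bound (e^-2)); apply: archi_boundP.
  by rewrite invr_ge0 exprn_ge0 // ltW.
have n0 : (0 < n)%N.
  by rewrite -(ltr0n R) (le_lt_trans _ hn) // invr_ge0 exprn_ge0 // ltW.
exists n => //.
have q01 : 0 <= 1 - e < 1 by apply/andP; split; lra.
have p0 : 0 <= (1 - e) ^+ n by rewrite exprn_ge0 //; case/andP: q01.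
(* the powers of 1 - e decrease, so n (1 - e)^n is at most their sum, hence 1 / e *)
have n_le : n%:R * (1 - e) ^+ n <= e^-1.
  apply: le_trans (_ : _ <= \sum_(t < n) (1 - e) ^+ t) _.
    rewrite -[n in n%:R]card_ord mulr_natl -sumr_const ler_sum // => t _.
    by case/andP: q01 => q0 q1; rewrite ler_wiXn2l ?(ltW q1) ?(ltnW (ltn_ord t)).
  have := sum_bin_expr_le 0 n q01; rewrite subKr expr1.
  by under eq_bigr do rewrite bin0 mul1r.
have e2 : e ^- 2 * (1 - e) ^+ n <= e^-1.
  by apply: le_trans n_le; rewrite ler_wpM2r // ltW.
by rewrite -ler_pdivlMl ?invr_gt0 ?exprn_gt0 // invrK expr2 mulfK ?gt_eqF // in e2.
Qed.

Theorem theorem2p5 (R : realType) (lambda : R) (lambda_gt0 : 0 < lambda)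
  (H : forall (n : nat) (a b : 'rV[R]_n),
     (0 < n)%N -> positive_vector a -> positive_vector b ->
     T_sum a b ^+ 2 <=
       2 * S_sum 2 a b + lambda * Num.sqrt (S_sum 1 a b * S_sum 3 a b)) :
  2 * Num.sqrt 2 <= lambda.
Proof.
set r := Num.sqrt 2 : R.
have r2 : r ^+ 2 = 2 by rewrite sqr_sqrtr.
have r0 : 0 < r by rewrite sqrtr_gt0.
(* as r ^ 2 = 2, this is 4 <= lambda * r, that is 2 * r * r <= lambda * r *)
suff key : 1 <= 3^-1 + lambda * (r / 6).
  have : 2 * r * r <= lambda * r by rewrite -mulrA -expr2 r2; lra.
  by rewrite ler_pM2r.
(* (1 - e)^4 >= 1 - 4 e, so a loss d allows e = d / 4 *)
apply/ler_addgt0Pr => d d0.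
pose e := Num.min (d / 4) (2^-1).
have e0 : 0 < e by rewrite lt_min divr_gt0 // invr_gt0 ltr0n.
have e1 : e < 1 by rewrite gt_min; apply/orP; right; lra.
have ed : 4 * e <= d.
  by have : e <= d / 4 by [rewrite ge_min lexx]; lra.
have [n n0 hn] := exists_expr_le (introT andP (conj e0 e1)).
pose q := 1 - e; have q01 : 0 < q < 1 by rewrite /q; lra.
have eq : 1 - q = e by rewrite /q; lra.
set a := geometric_vector q n; set b := integer_vector R n.
have a0 : positive_vector a.
  by move=> k; rewrite mxE mulr_gt0 ?ltr0n ?exprn_gt0 //; case/andP: q01.
have b0 : positive_vector b by move=> k; rewrite mxE ltr0n.
have T_ge : (1 - e) ^+ 2 <= e * T_sum a b.
  rewrite -[X in X * T_sum _ _]eq mul_T_sum_geometric /q expr2.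
  by rewrite ler_wpM2l //; lra.
have S_le j : (j <= 3)%N -> S_sum (3 - j) a b <= (j`!%:R / 6) / e ^+ j.+1.
  by rewrite -eq; apply: S_sum_geometric_le.
have S1 : S_sum 1 a b <= 2 / 6 / e ^+ 3 := S_le 2%N isT.
have S2 : S_sum 2 a b <= 1 / 6 / e ^+ 2 := S_le 1%N isT.
have S3 : S_sum 3 a b <= 1 / 6 / e ^+ 1 := S_le 0%N isT.
have S_ge0 m : 0 <= S_sum m a b.
  do 2!(apply: sumr_ge0 => ? _).
  by rewrite divr_ge0 ?exprn_ge0 ?addr_ge0 ?mulr_ge0 // ltW.
have sqrt_le : Num.sqrt (S_sum 1 a b * S_sum 3 a b) <= r / 6 / e ^+ 2.
  have x0 : 0 <= r / 6 / e ^+ 2 by rewrite !divr_ge0 ?exprn_ge0 // ltW.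
  rewrite -[leRHS]ger0_norm // -sqrtr_sqr ler_wsqrtr //.
  have -> : (r / 6 / e ^+ 2) ^+ 2 = (2 / 6 / e ^+ 3) * (1 / 6 / e ^+ 1).
    by rewrite -[X in X / 6 / e ^+ 3]r2; field; rewrite gt_eqF.
  exact: ler_pM.
have T2_le : T_sum a b ^+ 2 <= (3^-1 + lambda * (r / 6)) / e ^+ 2.
  apply: le_trans (H n a b n0 a0 b0) _.
  have := ler_wpM2l (ltW lambda_gt0) sqrt_le; lra.
rewrite ler_pdivlMr ?exprn_gt0 // mulrC -exprMn in T2_le.
have : ((1 - e) ^+ 2) ^+ 2 <= (e * T_sum a b) ^+ 2.
  by rewrite lerXn2r ?nnegrE ?exprn_ge0 ?(le_trans _ T_ge) ?exprn_ge0 //; lra.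
(* applied at e, then at 1 - (1 - e)^2 *)
have lin (x : R) : 1 - 2 * x <= (1 - x) ^+ 2.
  by have := sqr_ge0 x; rewrite !expr2; lra.
have := lin e; have := lin (1 - (1 - e) ^+ 2); rewrite subKr; lra.
Qed.
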